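(* Let $A,B,C$ be complex vector spaces of dimension $3$ with bases $a_0,a_1,a_2$, $b_0,b_1,b_2$, $c_0,c_1,c_2$, and let $$T_{skewcw,2}=\sum_{j=1}^2\left(a_0\otimes b_j\otimes c_j+a_j\otimes b_0\otimes c_j\right)+\left(a_1\otimes b_2-a_2\otimes b_1\right)\otimes c_0.$$ Then $\underline{\mathbf{R}}(T_{skewcw,2}^{\boxtimes 2})\le 17$.
   Context: The border rank $\underline{\mathbf{R}}(T)$ of a tensor $T$ is the smallest $r$ such that $T$ is a limit of a sequence of sums of $r$ tensors of the form $a\otimes b\otimes c$. The Kronecker square $T^{\boxtimes 2}$ is $T\otimes T$ regarded as a 3-way tensor in $(A\otimes A)\otimes(B\otimes B)\otimes(C\otimes C)$. *)

(* Defs.v *)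
From HB Require Import structures.
From mathcomp Require Import all_boot all_order all_algebra.
From mathcomp Require Import complex.
From mathcomp Require Import all_classical all_reals topology normedtype sequences.
Set Implicit Arguments.
Unset Strict Implicit.
Unset Printing Implicit Defensive.
Import Order.TTheory GRing.Theory Num.Theory.
Import numFieldNormedType.Exports.
Local Open Scope classical_set_scope.
Local Open Scope ring_scope.

(* Spaces with a fixed basis indexed by a finite type I are identified with
   the coordinate space vec R I, and the tensor product of three of them with
   the space of three-way arrays of coordinates. The complex field is R[i]. *)
Notation vec R I := {ffun I -> R[i]}.
Notation tensor R I J K := {ffun I * J * K -> R[i]}.

Definition basis_vec (R : realType) (I : finType) (i : I) : vec R I :=
  [ffun i' => (i' == i)%:R].

Definition simple_tensor (R : realType) (I J K : finType)
    (a : vec R I) (b : vec R J) (c : vec R K) :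
    tensor R I J K :=
  [ffun x => a x.1.1 * b x.1.2 * c x.2].

(* The summands may vanish, so this means rank at most r. *)
Definition sum_of_simple (R : realType) (I J K : finType) (r : nat)
    (T : tensor R I J K) : Prop :=
  exists (a : 'I_r -> vec R I) (b : 'I_r -> vec R J)
         (c : 'I_r -> vec R K),
    T = \sum_(s < r) simple_tensor (a s) (b s) (c s).

(* In finite dimension the topology is that of entrywise convergence; the
   regular algebra R[i]^o carries the topology given by the modulus. *)
Definition tensor_cvg (R : realType) (I J K : finType)
    (S : nat -> tensor R I J K) (T : tensor R I J K) : Prop :=
  forall x, (fun n => S n x : R[i]^o) @ \oo --> (T x : R[i]^o).

Definition limit_of_sums (R : realType) (I J K : finType)
    (T : tensor R I J K) (r : nat) : Prop :=
  exists S : nat -> tensor R I J K,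
    (forall n, sum_of_simple r (S n)) /\ tensor_cvg S T.

Lemma limit_of_sums_ex (R : realType) (I J K : finType)
    (T : tensor R I J K) : exists r, `[< limit_of_sums T r >].
Proof.
exists #|{: I * J * K}|; apply/asboolP; exists (fun=> T); split; last first.
  by move=> x; exact: cvg_cst.
move=> _; exists (fun s => [ffun i => T (enum_val s) * basis_vec R (enum_val s).1.1 i]).
exists (fun s => basis_vec R (enum_val s).1.2).
exists (fun s => basis_vec R (enum_val s).2).
apply/ffunP => -[[i j] k]; rewrite sum_ffunE.
rewrite (bigD1 (enum_rank ((i, j), k))) //= !ffunE enum_rankK /= !eqxx !mulr1.
rewrite big1 ?addr0 // => s; rewrite -(inj_eq enum_val_inj) enum_rankK => neq.
rewrite !ffunE /=; apply: contraNeq neq; rewrite !mulf_eq0 !negb_or !pnatr_eq0.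
rewrite !eqb0 !negbK; case: (enum_val s) => -[i' j'] k' /=.
by case/andP => /andP[/andP[_ /eqP->] /eqP->] /eqP->.
Qed.

Definition border_rank (R : realType) (I J K : finType)
    (T : tensor R I J K) : nat :=
  ex_minn (limit_of_sums_ex T).

(* The basis of A (x) A is indexed by pairs (i, i'). *)
Definition kronecker (R : realType) (I J K I' J' K' : finType)
    (S : tensor R I J K) (T : tensor R I' J' K') :
    tensor R (I * I')%type (J * J')%type (K * K')%type :=
  [ffun x => S (x.1.1.1, x.1.2.1, x.2.1) * T (x.1.1.2, x.1.2.2, x.2.2)].

Definition skewcw2 (R : realType) : tensor R 'I_3 'I_3 'I_3 :=
  let e (i : nat) : vec R 'I_3 := basis_vec R (inord i) in
  \sum_(1 <= j < 3) (simple_tensor (e 0%N) (e j) (e j)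
                     + simple_tensor (e j) (e 0%N) (e j))
  + (simple_tensor (e 1%N) (e 2%N) (e 0%N) - simple_tensor (e 2%N) (e 1%N) (e 0%N)).

(* Main.v *)
(* Up to signs and a renaming of the basis of C, skewcw2 is the alternating form
   on C^3, so its Kronecker square is the polarised determinant of 3x3 matrices
   X = [[a, x], [z, Y]], with a scalar and Y of size 2x2. Give a, (x, z), Y the
   weights 0, 1, 2; then det X = a det Y - x adj(Y) z is homogeneous of weight 4,
   and scaling by the corresponding torus reduces the problem to finding 17
   linear forms l_s and coefficients c_s such that \sum_s c_s l_s^3 is det plus
   terms of weight more than 4.
   Let w be a primitive cube root of unity, and let r_1, ..., r_4 be the vectors
   (1, 0), (0, 1), (w, w^2), (-w^2, w). Their Galois conjugates z_j satisfy
   \sum_j r_j^2 = \sum_j z_j^2 = 0 and [r_j, r_k][z_j, z_k] = 1 for all j != k.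
   With P_j = z_j r_j and S = \sum_j P_j, it follows from these identities that
   the following 8 + 8 + 1 forms, written as matrices (a, x, z, Y), work up to
   rescaling:
     (1, +-r_j, -+z_j, S/2 - P_j) with coefficient 1,
     (1, +-r_j/d, +-z_j/d, P_j - S/6) with coefficient -3, where d^2 = -3,
     (1, 0, 0, 0) with coefficient 16. *)

Require Import Defs.
From mathcomp Require Import all_boot all_reals.
From mathcomp Require Import all_order all_algebra complex.
From mathcomp Require Import all_classical topology normedtype sequences.
From mathcomp Require Import ring.
Set Implicit Arguments.
Unset Strict Implicit.
Unset Printing Implicit Defensive.
Import Order.TTheory GRing.Theory Num.Theory.
Import numFieldNormedType.Exports.

Section Eisenstein.
Local Open Scope ring_scope.

(* (m, n) stands for m + n w, where w ^+ 2 = - 1 - w. *)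
Definition eisenstein := (int * int)%type.
Implicit Types x y : eisenstein.

Definition eis_of_int (m : int) : eisenstein := (m, 0).
Definition eis_add x y : eisenstein := (x.1 + y.1, x.2 + y.2).
Definition eis_mul x y : eisenstein :=
  (x.1 * y.1 - x.2 * y.2, x.1 * y.2 + x.2 * y.1 - x.2 * y.2).
Definition eis_conj x : eisenstein := (x.1 - x.2, - x.2).

Variables (F : fieldType) (w : F).

Definition eis_val x : F := x.1%:~R + x.2%:~R * w.

Lemma eis_val_int m : eis_val (eis_of_int m) = m%:~R.
Proof. by rewrite /eis_val /= mul0r addr0. Qed.

Lemma eis_val_add x y : eis_val (eis_add x y) = eis_val x + eis_val y.
Proof. by rewrite /eis_val /= !rmorphD /=; ring. Qed.

Hypothesis w2 : w ^+ 2 = - 1 - w.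

Lemma eis_val_mul x y : eis_val (eis_mul x y) = eis_val x * eis_val y.
Proof.
rewrite /eis_val /= !(rmorphB, rmorphD) /= !rmorphM /=.
have -> : (x.1%:~R + x.2%:~R * w) * (y.1%:~R + y.2%:~R * w) =
  x.1%:~R * y.1%:~R + (x.1%:~R * y.2%:~R + x.2%:~R * y.1%:~R) * w
  + x.2%:~R * y.2%:~R * w ^+ 2 :> F by ring.
by rewrite w2; ring.
Qed.

Lemma eis_val_sum (T : Type) (f : T -> eisenstein) (s : seq T) :
  eis_val (foldr (fun u => eis_add (f u)) (eis_of_int 0) s) =
  \sum_(u <- s) eis_val (f u).
Proof.
elim: s => [|u s IH] /=; first by rewrite big_nil eis_val_int.
by rewrite big_cons eis_val_add IH.
Qed.

End Eisenstein.

Section Nodes.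
Local Open Scope ring_scope.

Definition frame : seq (eisenstein * eisenstein) :=
  [:: ((1, 0), (0, 0)); ((0, 0), (1, 0)); ((0, 1), (-1, -1)); ((1, 1), (0, 1))].

(* The entries, row by row, of [[1, a r], [b conj r, k S + l (conj r) r]], where
   S is the sum over the frame of the matrices (conj r) r. *)
Definition node_form (a b : eisenstein) (k l : int)
    (r : eisenstein * eisenstein) : seq eisenstein :=
  let block (s x y : eisenstein) :=
    eis_add (eis_mul (eis_of_int k) s)
            (eis_mul (eis_of_int l) (eis_mul (eis_conj x) y)) in
  [:: eis_of_int 1; eis_mul a r.1; eis_mul a r.2;
      eis_mul b (eis_conj r.1); block (3, 0) r.1 r.1; block (1, 2) r.1 r.2;
      eis_mul b (eis_conj r.2); block (-1, -2) r.2 r.1; block (3, 0) r.2 r.2].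

(* The blocks of the forms of the header are rescaled by 1, 2d and -12, where
   d = 1 + 2w is a square root of -3 (so (2, 4) is 2d); the weight-4 part of
   the sum is then 576 times the determinant tensor. *)
Definition nodes : seq (int * seq eisenstein) :=
  (16, [:: eis_of_int 1]) ::
  flatten [seq [:: (1, node_form (2, 4) (-2, -4) (-6) 12 r);
                   (1, node_form (-2, -4) (2, 4) (-6) 12 r);
                   (-3, node_form (2, 0) (2, 0) 2 (-12) r);
                   (-3, node_form (-2, 0) (-2, 0) 2 (-12) r)] | r <- frame].

(** The default of [nth] pads the one-entry node with zeros, making it (1, 0, 0, 0). *)
Definition form_entry (u : seq eisenstein) (p : nat * nat) : eisenstein :=
  nth (eis_of_int 0) u (3 * p.1 + p.2).

(* The substitution b0 -> -b0, c1 -> c2, c2 -> -c1 turns skewcw2 into the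
   alternating form. *)
Definition twist_b (j : nat) : int := nth 0 [:: -1; 1; 1] j.
Definition twist_c (k : nat) : int := nth 0 [:: 1; 1; -1] k.
Definition swap_c (k : nat) : nat := nth 0 [:: 0; 2; 1]%N k.

Definition node_a (u : int * seq eisenstein) p :=
  eis_mul (eis_of_int u.1) (form_entry u.2 p).
Definition node_b (u : int * seq eisenstein) (p : nat * nat) :=
  eis_mul (eis_of_int (twist_b p.1 * twist_b p.2)) (form_entry u.2 p).
Definition node_c (u : int * seq eisenstein) (p : nat * nat) :=
  eis_mul (eis_of_int (twist_c p.1 * twist_c p.2))
          (form_entry u.2 (swap_c p.1, swap_c p.2)).

Definition node_sum p q r : eisenstein :=
  foldr (fun u =>
      eis_add (eis_mul (eis_mul (node_a u p) (node_b u q)) (node_c u r)))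
    (eis_of_int 0) nodes.

Definition skewcw2_entry (i j k : nat) : int :=
  if (i, j, k) \in [:: (0, 1, 1); (0, 2, 2); (1, 0, 1); (2, 0, 2); (1, 2, 0)]%N
  then 1 else if (i, j, k) == (2, 1, 0)%N then -1 else 0.

Definition weight (p : nat * nat) : nat := (0 < p.1)%N + (0 < p.2)%N.

Definition index_pairs : seq (nat * nat) := allpairs pair (iota 0 3) (iota 0 3).

(** After division by t^4, weights below 4 would blow up and must cancel; weights above 4 die in the
    limit, so their sums stay unconstrained. *)
Definition node_sum_spec p q r : bool :=
  let T := skewcw2_entry p.1 q.1 r.1 * skewcw2_entry p.2 q.2 r.2 in
  let W := (weight p + weight q + weight r)%N in
  if W == 4%N then node_sum p q r == eis_of_int (576 * T)
  else (T == 0) && ((W <= 4)%N ==> (node_sum p q r == eis_of_int 0)).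

Lemma node_sumP :
  all (fun p => all (fun q => all (node_sum_spec p q) index_pairs)
                    index_pairs) index_pairs.
Proof. by vm_compute. Qed.

End Nodes.

Section Limits.
Local Open Scope classical_set_scope.
Local Open Scope ring_scope.

Lemma cvg_complex_harmonic (R : realType) :
  (fun n => harmonic n : R[i]^o) @ \oo --> (0 : R[i]^o).
Proof.
(* A positive [e] in [R[i]] is real, which reduces the claim to the real sequence. *)
apply/cvgrPdist_lt => e; rewrite ltcE /= => /andP[/eqP im_e re_e].
have /cvgrPdist_lt/(_ _ re_e) := @cvg_harmonic R.
apply: filterS => n; rewrite !sub0r !normrN !gtr0_norm ?harmonic_gt0 // => lt_e.
rewrite /= in lt_e *.
have -> : n.+1%:R^-1 = (n.+1%:R^-1 : R)%:C%C :> R[i] by rewrite fmorphV rmorph_nat.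
by rewrite ltcE /= -im_e eqxx.
Qed.

Lemma cvg_complex_harmonicXS (R : realType) k :
  (fun n => harmonic n ^+ k.+1 : R[i]^o) @ \oo --> (0 : R[i]^o).
Proof.
elim: k => [|k IH]; first exact: cvg_complex_harmonic.
rewrite (_ : (fun n => _) =
  (harmonic : nat -> R[i]) \* (fun n => harmonic n ^+ k.+1)).
  rewrite -[X in _ --> X](mulr0 (0 : R[i])).
  by apply: (@cvgM R[i]); [exact: cvg_complex_harmonic | exact: IH].
by apply/funext => n; rewrite /= exprS.
Qed.

Lemma cvg_constant (K : numFieldType) (f : nat -> K) (l : K) :
  (forall n, f n = l) -> (f n : K^o) @[n --> \oo] --> (l : K^o).
Proof. by move=> fE; rewrite (_ : f = fun=> l); [exact: cvg_cst | exact/funext]. Qed.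

Lemma border_rank_le (R : realType) (I J K : finType) (T : tensor R I J K) r :
  limit_of_sums T r -> (border_rank T <= r)%N.
Proof.
by move=> lim; rewrite /border_rank; case: ex_minnP => m _; apply; apply/asboolP.
Qed.

Lemma skewcw2E (R : realType) (i j k : 'I_3) :
  skewcw2 R (i, j, k) = (skewcw2_entry i j k)%:~R.
Proof.
have inordE (m : nat) (l : 'I_3) : (m < 3)%N -> (l == inord m) = (l == m :> nat).
  by move=> lt_m3; rewrite -val_eqE /= inordK.
rewrite /skewcw2 big_nat_recr //= big_nat1 !ffunE /= !inordE //.
case: i => [[|[|[|//]]] ?]; case: j => [[|[|[|//]]] ?];
  case: k => [[|[|[|//]]] ?];
  by rewrite /= !(mulr0, mul0r, mulr1, addr0, add0r, subr0, sub0r, oppr0).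
Qed.

Lemma node_sum_index (p q r : 'I_3 * 'I_3) :
  node_sum_spec (p.1 : nat, p.2 : nat) (q.1 : nat, q.2 : nat) (r.1 : nat, r.2 : nat).
Proof.
have mem (u : 'I_3 * 'I_3) : (u.1 : nat, u.2 : nat) \in index_pairs.
  by apply: allpairs_f; rewrite mem_iota ltn_ord.
exact: (allP (allP (allP node_sumP _ (mem p)) _ (mem q)) _ (mem r)).
Qed.

Section Approximation.
Variables (R : realType) (w : R[i]).
Hypothesis w2 : w ^+ 2 = - 1 - w.

Let pos (p : 'I_3 * 'I_3) : nat * nat := (p.1 : nat, p.2 : nat).

Definition scaled_form (t : R[i]) (f : nat * nat -> eisenstein) :
    vec R ('I_3 * 'I_3)%type :=
  [ffun p => t ^+ weight (pos p) * eis_val w (f (pos p))].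

(** The normalisation goes into the first factor, so that each summand stays simple. *)
Definition scaled_sum (t : R[i]) :
    tensor R ('I_3 * 'I_3)%type ('I_3 * 'I_3)%type ('I_3 * 'I_3)%type :=
  \sum_(s < 17) let u := nth (0, [::]) nodes s in
    simple_tensor [ffun p => scaled_form t (node_a u) p / (576%:R * t ^+ 4)]
      (scaled_form t (node_b u)) (scaled_form t (node_c u)).

Lemma scaled_sumE t p q r : scaled_sum t (p, q, r) =
  t ^+ (weight (pos p) + weight (pos q) + weight (pos r))
  / (576%:R * t ^+ 4) * eis_val w (node_sum (pos p) (pos q) (pos r)).
Proof.
rewrite /node_sum eis_val_sum (big_nth (0, [::])) big_mkord sum_ffunE mulr_sumr.
apply: eq_bigr => s _; rewrite !ffunE /= !eis_val_mul // !exprD.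
by ring.
Qed.

Lemma scaled_sum_cvg :
  tensor_cvg (fun n => scaled_sum (harmonic n))
    (kronecker (skewcw2 R) (skewcw2 R)).
Proof.
move=> [[p q] r]; rewrite ffunE /= !skewcw2E -rmorphM /=.
have := node_sum_index p q r; rewrite /node_sum_spec /=.
set T := skewcw2_entry _ _ _ * _; set W := (weight _ + _ + _)%N.
have t0 n : harmonic n != 0 :> R[i] by rewrite gt_eqF ?harmonic_gt0.
have cancel_t4 (t x : R[i]) k : t != 0 ->
    t ^+ (4 + k) / (576%:R * t ^+ 4) * x = t ^+ k * (x / 576%:R).
  by move=> tn0; rewrite exprD; field.
pose g : R[i] := eis_val w (node_sum (pos p) (pos q) (pos r)).
have SE t : scaled_sum t (p, q, r) = t ^+ W / (576%:R * t ^+ 4) * g.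
  exact: scaled_sumE.
case: eqP => [W4 /eqP gE | _ /andP[/eqP -> /implyP gE]].
  apply: cvg_constant => n; rewrite SE W4 /g gE eis_val_int rmorphM /=.
  by rewrite (cancel_t4 _ _ 0%N); [rewrite expr0; field | exact: t0].
case: (leqP W 4) => [/gE/eqP g0 | lt4W].
  by apply: cvg_constant => n; rewrite SE /g g0 eis_val_int mulr0.
(* The exponent [W - 4] left on [t] is written as a successor to show it is positive. *)
have WE : W = (4 + (W - 5).+1)%N by rewrite addnS -addSn subnKC.
have SEk : (fun n => scaled_sum (harmonic n) (p, q, r)) =
    (fun n => harmonic n ^+ (W - 5).+1 * (g / 576%:R)).
  by apply/funext => n; rewrite SE {1}WE cancel_t4.
rewrite SEk -[0%:~R](mul0r (g / 576%:R)).
apply: (@cvgMr_tmp _ _ _ _ _ (0 : R[i])); exact: cvg_complex_harmonicXS.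
Qed.

End Approximation.

End Limits.

Theorem theorem2p7 (R : realType) :
  border_rank (kronecker (skewcw2 R) (skewcw2 R)) <= 17.
Proof.
apply: border_rank_le.
have [w w2] : exists w : R[i], (w ^+ 2 = - 1 - w)%R.
  pose s : R[i] := sqrtC (- 3)%R; exists ((s - 1) / 2)%R.
  have s2 : (s ^+ 2 = - 3)%R by rewrite sqrtCK.
  have -> : (((s - 1) / 2) ^+ 2 = (s ^+ 2 - 2 * s + 1) / 4)%R by field.
  by rewrite s2; field.
exists (fun n => scaled_sum w (harmonic n)); split; last exact: scaled_sum_cvg.
by move=> n; do 3 eexists.
Qed.
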